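(* Let $n\ge2$. A permutation $\tau=b_1\ldots b_n$ satisfies $\tau=T^{n-2}(\pi)$ for some permutation $\pi$ of size $n$ if and only if $\max_i|b_i-i|\le1$ and $\tau$ has no inner run of odd length. Consequently, the number of such $\tau$ is $2^{n/2-1}+2^{n/2}-1$ if $n$ is even and $2^{(n+1)/2}-1$ if $n$ is odd.
   Context: Runs of a permutation are its maximal increasing strings of consecutive entries; falls are its maximal decreasing strings of consecutive entries. The flip $T$ reverses every fall in place; $T^m$ is its $m$-fold iterate. If a permutation has runs $R_1,\dots,R_s$ from left to right with $s\ge2$, the runs $R_i$ with $1<i<s$ are its inner runs. *)

(* Defs.v *)
From mathcomp Require Import all_boot all_order all_fingroup all_algebra.

Set Implicit Arguments.
Unset Strict Implicit.
Unset Printing Implicit Defensive.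

(* The decomposition of a word into its maximal e-chains of consecutive
   entries, from left to right; its defining properties are flatten_blocks,
   blocks_chain and blocks_maximal. *)
Fixpoint blocks (e : rel nat) (w : seq nat) : seq (seq nat) :=
  if w is x :: w' then
    if blocks e w' is (y :: b) :: bs then
      if e x y then (x :: y :: b) :: bs else [:: x] :: (y :: b) :: bs
    else [:: [:: x]]
  else [::].

Definition runs : seq nat -> seq (seq nat) := blocks (fun x y => x < y).

Definition falls : seq nat -> seq (seq nat) := blocks (fun x y => y < x).

Definition flip (w : seq nat) : seq nat := flatten (map rev (falls w)).

(* All runs but the first and the last. *)
Definition inner_runs (w : seq nat) : seq (seq nat) :=
  behead (take (size (runs w)).-1 (runs w)).

(* One-line notation b_1 ... b_n with entries in {1, ..., n}; permutations in
   'S_n act on {0, ..., n - 1}, so b_(i + 1) = t i + 1. *)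
Definition word (n : nat) (t : 'S_n) : seq nat := [seq (t i).+1 | i : 'I_n].

Lemma blocks_head (e : rel nat) (x : nat) (w : seq nat) :
  exists b bs, blocks e (x :: w) = (x :: b) :: bs.
Proof.
rewrite /=; case: (blocks e w) => [|[|y b] bs]; try by exists [::], [::].
by case: (e x y); [exists (y :: b), bs | exists [::], ((y :: b) :: bs)].
Qed.

Lemma flatten_blocks (e : rel nat) (w : seq nat) : flatten (blocks e w) = w.
Proof.
elim: w => [//|x [//|y w] IH].
have [b [bs E]] := blocks_head e y w.
by move: IH; rewrite [blocks e (x :: _)]/= -/(blocks e (y :: w)) E;
  case: (e x y) => /= ->.
Qed.

Lemma blocks_chain (e : rel nat) (w : seq nat) :
  all (fun b => (b != [::]) && sorted e b) (blocks e w).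
Proof.
elim: w => [//|x [//|y w] IH].
have [b [bs E]] := blocks_head e y w.
move: IH; rewrite [blocks e (x :: _)]/= -/(blocks e (y :: w)) E.
by case exy: (e x y); rewrite /= ?exy.
Qed.

Lemma blocks_maximal (e : rel nat) (w : seq nat) :
  sorted (fun b c => ~~ e (last 0 b) (head 0 c)) (blocks e w).
Proof.
elim: w => [//|x [//|y w] IH].
have [b [bs E]] := blocks_head e y w.
move: IH; rewrite [blocks e (x :: _)]/= -/(blocks e (y :: w)) E.
by case exy: (e x y); rewrite /= ?exy; case: bs {E}.
Qed.

(* Main.v *)
(* Follow the 0-1 principle.  For a threshold k, count the entries <= k in each
   prefix; one flip never decreases these counts, and increases the count of a
   prefix that ends between an entry > k and an entry <= k.  As for odd-even
   transposition sort, after n - 2 flips the 0-1 word of threshold k is either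
   sorted or has exactly the two entries k, k+1 out of place, which makes the
   result thin with a descent at each threshold of the second kind.  Such a
   descent is the end of a chain of prefixes whose counts were as small as
   possible at all earlier times, whose lengths change by one at each step and
   go from n - k to k.  For two descents of opposite parity the two chains would
   have to cross between neighbouring lengths, which a fall of length three
   prevents.

   Conversely, run the odd-even transposition network backwards from the
   identity for n - 1 steps: every fall on the way has length at most two, and
   the last step swaps all pairs of one parity.  Exchanging some of these pairs
   of values x, x+1 beforehand affects no earlier comparison, so every set of
   descents of one parity is reached.  A thin permutation is determined by its
   descent set, and its inner runs are even exactly when its descents all have
   the same parity. *)
Require Import Defs.
From mathcomp Require Import all_boot all_order all_fingroup all_algebra zify.

Set Implicit Arguments.
Unset Strict Implicit.
Unset Printing Implicit Defensive.

(** * Induction over runs and falls *)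

Lemma blocks_cons (e : rel nat) (x : nat) (w : seq nat) :
  exists b w', [/\ x :: w = (x :: b) ++ w',
    blocks e (x :: w) = (x :: b) :: blocks e w', sorted e (x :: b) &
    w' = [::] \/ ~~ e (last x b) (head 0 w')].
Proof.
elim: w x => [|y w IH] x; first by exists [::], [::]; split=> //; left.
have [b [w' [Ew Eb sb mb]]] := IH y.
have E : blocks e (x :: y :: w) = if e x y then (x :: y :: b) :: blocks e w'
    else [:: x] :: blocks e (y :: w).
  by rewrite [LHS]/= -/(blocks e (y :: w)) Eb.
case exy: (e x y) E => E.
  by exists (y :: b), w'; split=> //=; rewrite ?Ew //= exy.
by exists [::], (y :: w); split=> //; right; rewrite /= exy.
Qed.

Lemma blocks_ind (e : rel nat) (P : seq nat -> seq (seq nat) -> Prop) :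
  P [::] [::] ->
  (forall b w : seq nat, b != [::] -> sorted e b ->
     w = [::] \/ ~~ e (last 0 b) (head 0 w) ->
     P w (blocks e w) -> P (b ++ w) (b :: blocks e w)) ->
  forall w, P w (blocks e w).
Proof.
move=> P0 PS w; have [m] := ubnP (size w).
elim: m w => // m IH [|x w] //= /ltnSE lew.
have [b [w' [Ew Eb sb mb]]] := blocks_cons e x w.
rewrite -/(blocks e (x :: w)) Eb Ew; apply: PS => //; apply: IH.
by move: Ew => [Ew]; apply: leq_trans lew; rewrite Ew size_cat ltnS leq_addl.
Qed.

Lemma flip_ind (P : seq nat -> seq nat -> Prop) :
  P [::] [::] ->
  (forall b w : seq nat, b != [::] -> sorted (fun x y => y < x) b ->
     w = [::] \/ last 0 b <= head 0 w ->
     P w (flip w) -> P (b ++ w) (rev b ++ flip w)) ->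
  forall w, P w (flip w).
Proof.
move=> P0 PS; apply: (blocks_ind (P := fun w bs => P w (flatten (map rev bs)))).
  exact: P0.
by move=> b w nb sb mb Pw; apply: PS => //; rewrite leqNgt.
Qed.

Lemma perm_flip (w : seq nat) : perm_eq (flip w) w.
Proof.
apply: (flip_ind (P := fun w v => perm_eq v w)) w => // b w _ _ _ IH.
by apply: perm_cat; rewrite ?perm_rev.
Qed.

Lemma perm_iter_flip (t : nat) (w : seq nat) : perm_eq (iter t flip w) w.
Proof.
by elim: t => [|t IH] //=; apply: perm_trans IH; apply: perm_flip.
Qed.

(** * Low entries in prefixes under one flip *)

Definition nlow (k : nat) (w : seq nat) (q : nat) : nat :=
  count (fun v => v <= k) (take q w).

Lemma nlowS (k q : nat) (w : seq nat) :
  q < size w -> nlow k w q.+1 = nlow k w q + (nth 0 w q <= k).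
Proof.
by move=> lq; rewrite /nlow (take_nth 0) // -cats1 count_cat /= addn0.
Qed.

Lemma nlow_cat (k q : nat) (b w : seq nat) :
  nlow k (b ++ w) q =
  if q < size b then nlow k b q else count (leq^~ k) b + nlow k w (q - size b).
Proof. by rewrite /nlow take_cat; case: ifP => // _; rewrite count_cat. Qed.

Lemma gtn_trans : transitive (fun x y : nat => y < x).
Proof. by move=> y x z; lia. Qed.

(** The reversed fall is increasing, so its low entries come first and a prefix holds as many of
    them as its length allows. *)
Lemma nlow_rev (k q : nat) (b : seq nat) :
  sorted (fun x y => y < x) b -> q <= size b -> nlow k b q <= nlow k (rev b) q.
Proof.
move=> sb lq; have {}sb : sorted ltn (rev b) by rewrite rev_sorted.
case: q lq => [|q] lq; first by rewrite /nlow !take0.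
have [le|gt] := leqP (nth 0 (rev b) q) k.
  suff -> : nlow k (rev b) q.+1 = q.+1.
    by rewrite (leq_trans (count_size _ _)) // size_takel.
  have sz : size (take q.+1 (rev b)) = q.+1 by rewrite size_takel // size_rev.
  rewrite -[RHS]sz; apply/eqP; rewrite -all_count.
  apply/(all_nthP 0) => i; rewrite sz => li; rewrite nth_take //.
  apply: leq_trans le; move: li; rewrite ltnS leq_eqVlt => /orP[/eqP->//|li].
  by apply: ltnW; apply: (sorted_ltn_nth ltn_trans) => //;
    rewrite inE size_rev; lia.
suff -> : nlow k (rev b) q.+1 = count (leq^~ k) (rev b).
  by rewrite count_rev -[in leqRHS](cat_take_drop q.+1 b) count_cat leq_addr.
rewrite -[in RHS](cat_take_drop q.+1 (rev b)) count_cat.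
suff -> : count (leq^~ k) (drop q.+1 (rev b)) = 0 by rewrite addn0.
apply/eqP; rewrite -leqn0 leqNgt -has_count; apply/(has_nthP 0) => -[i].
rewrite size_drop size_rev nth_drop => li.
apply/negP; rewrite -ltnNge; apply: ltn_trans gt _.
by apply: (sorted_ltn_nth ltn_trans) => //; rewrite ?inE ?size_rev; lia.
Qed.

Lemma nlow_flip (k q : nat) (w : seq nat) : nlow k w q <= nlow k (flip w) q.
Proof.
move: w q; apply: (flip_ind (P := fun w v => forall q, nlow k w q <= nlow k v q)).
  by [].
move=> b w _ sb _ IH q.
rewrite !nlow_cat size_rev; case: ifP => lq; first by apply: nlow_rev => //; lia.
by rewrite count_rev leq_add2l.
Qed.

(* Entries [p .. r] lie in one fall, which starts high and ends low; its
   reversal brings a low entry into the prefix. *)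
Lemma nlow_flip_lt (k p r : nat) (w : seq nat) :
  p < r < size w -> (forall i, p <= i < r -> nth 0 w i.+1 < nth 0 w i) ->
  k < nth 0 w p -> nth 0 w r <= k -> nlow k w p.+1 < nlow k (flip w) p.+1.
Proof.
move: w p r; apply: (flip_ind (P := fun w v => forall p r, p < r < size w ->
  (forall i, p <= i < r -> nth 0 w i.+1 < nth 0 w i) ->
  k < nth 0 w p -> nth 0 w r <= k -> nlow k w p.+1 < nlow k v p.+1)).
  by move=> p r /=; rewrite andbF.
move=> b w nb sb mb IH p r lpr dec hp hr.
have [lp|lp] := ltnP p (size b); last first.
  have lpb : (p.+1 < size b) = false by lia.
  rewrite !nlow_cat size_rev lpb count_rev ltn_add2l subSn //.
  apply: (IH _ (r - size b)).
  - by move: lpr; rewrite size_cat; lia.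
  - move=> i li; have := dec (size b + i); rewrite !nth_cat.
    by rewrite -addnS !ifN ?addKn; lia.
  - by move: hp; rewrite nth_cat ifN // -leqNgt.
  - by move: hr; rewrite nth_cat ifN // -leqNgt; lia.
have [lr|lr] := ltnP r (size b); last first.
  case: mb => [Ew|]; first by move: lpr; rewrite Ew cats0; lia.
  have := dec (size b).-1; rewrite !nth_cat prednK ?ltnn ?subnn; last by lia.
  by rewrite nth_last nth0 leqnn; lia.
have zero : nlow k b p.+1 = 0.
  apply/eqP; rewrite -leqn0 leqNgt -has_count; apply/(has_nthP 0) => -[i].
  rewrite size_takel // => li; rewrite nth_take //; apply/negP; rewrite -ltnNge.
  move: hp; rewrite nth_cat lp => /leq_trans; apply.
  move: li; rewrite ltnS leq_eqVlt => /orP[/eqP->//|li].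
  by apply: ltnW; apply: (sorted_ltn_nth gtn_trans) => //; rewrite inE; lia.
rewrite !nlow_cat size_rev; have -> : p.+1 < size b by lia.
rewrite zero /nlow -has_count; apply/(has_nthP 0); exists 0.
  by rewrite size_takel // size_rev.
rewrite nth_take // nth_rev; last by lia.
move: hr; rewrite nth_cat lr; apply: leq_trans.
have [->|ne] := eqVneq r (size b - 1) => //.
by apply: ltnW; apply: (sorted_ltn_nth gtn_trans) => //; rewrite ?inE; lia.
Qed.

(** * Counts after several flips and their extremal cases *)

Lemma count_leq_iota (n k : nat) : k <= n -> count (leq^~ k) (iota 1 n) = k.
Proof.
move=> lkn; rewrite -(subnKC lkn) iotaD count_cat.
have -> : count (leq^~ k) (iota 1 k) = k.
  rewrite -[RHS](size_iota 1 k); apply/eqP; rewrite -all_count.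
  by apply/allP => i; rewrite mem_iota; lia.
have -> : count (leq^~ k) (iota (1 + k) (n - k)) = 0; last by rewrite addn0.
apply/eqP; rewrite -leqn0 leqNgt -has_count; apply/hasPn => i.
by rewrite mem_iota; lia.
Qed.

Lemma size_perm_iota (n : nat) (w : seq nat) :
  perm_eq w (iota 1 n) -> size w = n.
Proof. by move/perm_size; rewrite size_iota. Qed.

Lemma nlow_full (n k q : nat) (w : seq nat) :
  perm_eq w (iota 1 n) -> k <= n -> n <= q -> nlow k w q = k.
Proof.
move=> pw lkn lnq; have sw := size_perm_iota pw.
by rewrite /nlow take_oversize ?sw // (seq.permP pw) count_leq_iota.
Qed.

Lemma nlow_ge (n k q : nat) (w : seq nat) :
  perm_eq w (iota 1 n) -> k <= n -> q <= n -> q <= nlow k w q + (n - k).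
Proof.
move=> pw lkn lqn; have sw := size_perm_iota pw.
have := count_size (leq^~ k) (drop q w); rewrite size_drop sw.
have: count (leq^~ k) (take q w ++ drop q w) = k.
  by rewrite cat_take_drop (seq.permP pw) count_leq_iota.
by rewrite count_cat /nlow; lia.
Qed.

Lemma nlow_leS (k q : nat) (w : seq nat) : nlow k w q <= nlow k w q.+1.
Proof.
have [lq|lq] := ltnP q (size w); first by rewrite nlowS // leq_addr.
by rewrite /nlow !take_oversize // ltnW.
Qed.

(** If the count at [q.+1] is not yet above [j], then entry [q] is high and entry [q.+1] low; both
    lie in one fall, and [nlow_flip_lt] applies. *)
Lemma nlow_step (n k j q : nat) (w : seq nat) :
  perm_eq w (iota 1 n) -> k <= n -> j < k ->
  j <= nlow k w q -> j < nlow k w q.+2 -> j < nlow k (flip w) q.+1.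
Proof.
move=> pw lkn ljk h0 h2; have sw := size_perm_iota pw.
have [lq|lq] := ltnP q.+1 n; last first.
  by rewrite (nlow_full _ lkn) //; apply: perm_trans pw; apply: perm_flip.
have F := nlow_flip k q.+1 w.
have [h1|h1] := ltnP j (nlow k w q.+1); first exact: leq_trans h1 F.
have E1 : nlow k w q.+1 = nlow k w q + (nth 0 w q <= k).
  by apply: nlowS; rewrite sw; lia.
have E2 : nlow k w q.+2 = nlow k w q.+1 + (nth 0 w q.+1 <= k).
  by apply: nlowS; rewrite sw; lia.
apply: leq_ltn_trans (_ : nlow k w q.+1 < _); first by lia.
apply: (@nlow_flip_lt k q q.+1); try lia.
by move=> i li; have -> : i = q by [lia]; lia.
Qed.

(** The bound models the slowest case: the [j]-th low entry starts at place [n - k + j], waits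
    [j - 1] flips and then advances one place per flip. *)
Lemma nlow_bound (n k : nat) (v : seq nat) :
  perm_eq v (iota 1 n) -> k <= n ->
  forall t j q, j <= k -> j <= q -> n - k + j.*2 <= q + t.+1 ->
  j <= nlow k (iter t flip v) q.
Proof.
move=> pv lkn; elim=> [|t IH] j q ljk ljq b.
  have [lq|lq] := leqP q n; last by rewrite (nlow_full pv) //; lia.
  by have := nlow_ge pv lkn lq; rewrite /=; lia.
have pw := perm_trans (perm_iter_flip t v) pv.
case: j ljk ljq b => [//|j] ljk; case: q => [//|q] ljq b.
by apply: (nlow_step pw) => //; apply: IH; lia.
Qed.

(* The extremal case of [nlow_bound]: with one more unit of [q] or [t] that
   lemma would force [j] low entries. *)
Definition tight (n k : nat) (v : seq nat) (t j q : nat) : Prop :=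
  [/\ j <= k, j <= q, n - k + j.*2 = q + t.+2 & nlow k (iter t flip v) q < j].

(** Contrapositive of [nlow_step]: a deficient count comes from a deficient one at a neighbouring
    length. Both moves preserve the equation in [tight]. *)
Lemma tight_pred (n k : nat) (v : seq nat) (t j q : nat) :
  perm_eq v (iota 1 n) -> k <= n -> tight n k v t.+1 j q ->
  [/\ 0 < j, 0 < q, q < n &
    tight n k v t j.-1 q.-1 \/ tight n k v t j q.+1].
Proof.
move=> pv lkn [ljk ljq E H].
have pw := perm_trans (perm_iter_flip t v) pv.
case: j ljk ljq E H => [|j] ljk; case: q => [|q] // ljq E H.
have [lq|lq] := ltnP q.+1 n; last first.
  move: H; rewrite (nlow_full _ lkn) //; first by lia.
  exact: perm_trans (perm_iter_flip _ _) pv.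
split=> //.
have [h0|h0] := leqP j (nlow k (iter t flip v) q); last by left; split=> //=; lia.
have [h2|h2] := ltnP j (nlow k (iter t flip v) q.+2); last by right; split; lia.
by move: H; rewrite ltnNge iterS (nlow_step pw).
Qed.

(** Only [n - k] entries are high, so the prefix holds at least [2j - 2] low ones; fewer than [j]
    leaves only [j = 1]. *)
Lemma tight_start (n k : nat) (v : seq nat) (j q : nat) :
  perm_eq v (iota 1 n) -> k <= n -> tight n k v 0 j q -> q = n - k.
Proof.
move=> pv lkn [ljk ljq E /= H].
have [lq|lq] := leqP q n; last by move: H; rewrite (nlow_full pv) //; lia.
by have := nlow_ge pv lkn lq; lia.
Qed.

(* Tight positions of thresholds of opposite parity cannot cross: a crossing
   needs adjacent entries [x > l >= y > k >= z], which lie in one fall, and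
   reversing that fall destroys the tightness for [k]. *)
Lemma tight_order (n k l : nat) (v : seq nat) :
  perm_eq v (iota 1 n) -> k < l -> l <= n -> odd k != odd l ->
  forall t j q i r, tight n k v t j q -> tight n l v t i r -> ~ q < r.
Proof.
move=> pv lkl lln par; have lkn : k <= n by lia.
elim=> [|t IH] j q i r Tk Tl lqr.
  by have := tight_start pv lkn Tk; have := tight_start pv lln Tl; lia.
have [j0 q0 qn Ck] := tight_pred pv lkn Tk.
have [i0 r0 rn Cl] := tight_pred pv lln Tl.
case: Tk Tl => [ljk ljq Ek Hk] [lil lir El Hl].
(* Lengths of opposite parity can change order in one step only if they are neighbours. *)
have odd_qr : odd q != odd r.
  have: odd (n - k + j.*2) = odd (q + t.+3) by rewrite Ek.
  have: odd (n - l + i.*2) = odd (r + t.+3) by rewrite El.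
  move: par; rewrite !oddD !odd_double !oddB //=.
  by case: (odd n) (odd k) (odd l) (odd q) (odd r) (odd t) => -[] [] [] [] [].
have [cross|far] := eqVneq r q.+1; last first.
  by case: Ck Cl => [Tk|Tk] [Tl|Tl]; apply: (IH _ _ _ _ Tk Tl); lia.
set w := iter t flip v.
have pw : perm_eq w (iota 1 n) := perm_trans (perm_iter_flip t v) pv.
have sw := size_perm_iota pw.
(* From here the two lengths are [q.+1] and [q.+2]. *)
case: q j0 q0 qn Ck ljq Ek Hk lqr odd_qr cross => // q j0 _ qn Ck ljq Ek Hk _ _.
move=> Er; subst r.
(* Unless the chain of [k] comes from [q.+2] and that of [l] from [q.+1], the order persists one
   step back and induction applies. *)
have [hk|hk] := ltnP (nlow k w q) j.-1.
  have Tk : tight n k v t j.-1 q by split=> //; lia.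
  by case: Cl => Tl; apply: (IH _ _ _ _ Tk Tl); lia.
have [hl|hl] := ltnP (nlow l w q.+3) i.
  have Tl : tight n l v t i q.+3 by split=> //; lia.
  by case: Ck => Tk; apply: (IH _ _ _ _ Tk Tl); lia.
have {Ck} Hk2 : nlow k w q.+2 < j.
  by case: Ck => [[_ _ _ Tk]|[]//]; move: hk; rewrite leqNgt Tk.
have {Cl} Hl1 : nlow l w q.+1 < i.-1.
  by case: Cl => [[]//|[_ _ _ Tl]]; move: hl; rewrite leqNgt Tl.
(* [nlow_bound] just applies at the two outer lengths; this places the three entries relative to [k]
   and [l]. *)
have Bk : j <= nlow k w q.+3 by apply: (nlow_bound pv); lia.
have Bl : i.-2 <= nlow l w q by apply: (nlow_bound pv); lia.
have k1 : nlow k w q.+1 = nlow k w q + (nth 0 w q <= k).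
  by apply: nlowS; rewrite sw; lia.
have k2 : nlow k w q.+2 = nlow k w q.+1 + (nth 0 w q.+1 <= k).
  by apply: nlowS; rewrite sw; lia.
have k3 : nlow k w q.+3 = nlow k w q.+2 + (nth 0 w q.+2 <= k).
  by apply: nlowS; rewrite sw; lia.
have l1 : nlow l w q.+1 = nlow l w q + (nth 0 w q <= l).
  by apply: nlowS; rewrite sw; lia.
have l2 : nlow l w q.+2 = nlow l w q.+1 + (nth 0 w q.+1 <= l).
  by apply: nlowS; rewrite sw; lia.
have l3 : nlow l w q.+3 = nlow l w q.+2 + (nth 0 w q.+2 <= l).
  by apply: nlowS; rewrite sw; lia.
have x_gt : l < nth 0 w q by clear -l1 Bl Hl1; lia.
have y_le : nth 0 w q.+1 <= l by clear -l2 l3 hl Hl1; lia.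
have y_gt : k < nth 0 w q.+1 by clear -k1 k2 hk Hk2; lia.
have z_le : nth 0 w q.+2 <= k by clear -k3 Bk Hk2; lia.
have low : nlow k w q.+1 < nlow k (flip w) q.+1.
  apply: (@nlow_flip_lt k q q.+2) => //; first by rewrite sw; lia.
    move=> p lp; have [->|->] : p = q \/ p = q.+1 by lia.
      exact: leq_ltn_trans y_le x_gt.
    exact: leq_ltn_trans z_le y_gt.
  exact: ltn_trans lkl x_gt.
by move: Hk; rewrite iterS -/w; clear -low k1 hk; lia.
Qed.

(** * Displacements and descents after [n - 2] flips *)

(** Non-strict, as the negation of the relation that defines [runs]. *)
Definition desc (w : seq nat) : pred nat :=
  fun i => (i.+1 < size w) && (nth 0 w i.+1 <= nth 0 w i).

Lemma nlow_leq (k q : nat) (w : seq nat) : nlow k w q <= q.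
Proof. by rewrite (leq_trans (count_size _ _)) // size_take; case: ltnP. Qed.

Lemma nlow_mono (k q r : nat) (w : seq nat) :
  q <= r -> nlow k w q <= nlow k w r.
Proof.
move=> /subnKC <-; elim: (r - q) => [|d IH]; first by rewrite addn0.
by apply: leq_trans IH _; rewrite addnS nlow_leS.
Qed.

Lemma iter_flip_thin (n : nat) (v : seq nat) (i : nat) :
  2 <= n -> perm_eq v (iota 1 n) -> i < n ->
  let b := nth 0 (iter (n - 2) flip v) i in b <= i.+2 /\ i <= b.
Proof.
move=> n2 pv lin; set w := iter _ _ _; move=> b.
have pw : perm_eq w (iota 1 n) := perm_trans (perm_iter_flip _ v) pv.
have sw := size_perm_iota pw.
have bw : b \in w by rewrite mem_nth // sw.
have bn : 1 <= b <= n by move: bw; rewrite (perm_mem pw) mem_iota; lia.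
split; rewrite leqNgt; apply/negP => lt.
  (* After [n - 2] flips, [nlow_bound] yields [j] low entries once [2j <= q + k - 1]. Here
     [j = q = i + 1] and [k = i + 2]; for the lower bound on [b], [j = k = b] and [q = b + 1]. *)
  have: i.+1 <= nlow i.+2 w i.+1 by apply: (nlow_bound pv); lia.
  rewrite nlowS ?sw // -/b (leqNgt b) lt addn0.
  by have := nlow_leq i.+2 i w; lia.
have h0 : b <= nlow b w b.+1 by apply: (nlow_bound pv); lia.
have h1 : nlow b w b.+1 <= nlow b w i by apply: nlow_mono.
have h2 : nlow b w i.+1 <= nlow b w n by apply: nlow_mono.
have h3 : nlow b w i.+1 = nlow b w i + 1 by rewrite nlowS ?sw // leqnn.
have h4 : nlow b w n = b by apply: (nlow_full pw); lia.
by lia.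
Qed.

(** Entry [i.+1] is at least [i.+1] by [iter_flip_thin], so at a descent entry [i] exceeds the
    threshold [i.+1] and the prefix lacks a low entry. *)
Lemma desc_tight (n : nat) (v : seq nat) (i : nat) :
  2 <= n -> perm_eq v (iota 1 n) -> desc (iter (n - 2) flip v) i ->
  i.+1 < n /\ tight n i.+1 v (n - 2) i.+1 i.+1.
Proof.
move=> n2 pv; set w := iter _ _ _.
have pw : perm_eq w (iota 1 n) := perm_trans (perm_iter_flip _ v) pv.
have sw := size_perm_iota pw.
case/andP; rewrite sw => lin di; split=> //.
have uw : uniq w by rewrite (perm_uniq pw) iota_uniq.
have ne : nth 0 w i != nth 0 w i.+1 by rewrite nth_uniq ?sw //; lia.
have [_ b2] := iter_flip_thin n2 pv lin; rewrite -/w in b2.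
split=> //; first by lia.
rewrite -/w nlowS ?sw; last by lia.
have -> : (nth 0 w i <= i.+1) = false by lia.
by have := nlow_leq i.+1 i w; lia.
Qed.

Lemma iter_flip_desc_parity (n : nat) (v : seq nat) (i j : nat) :
  2 <= n -> perm_eq v (iota 1 n) -> desc (iter (n - 2) flip v) i ->
  desc (iter (n - 2) flip v) j -> odd i = odd j.
Proof.
move=> n2 pv /(desc_tight n2 pv)[li Ti] /(desc_tight n2 pv)[lj Tj].
apply/eqP/negPn/negP => ne.
case: (ltngtP i j) => [lt|gt|E]; last by rewrite E eqxx in ne.
  by apply: (tight_order pv _ _ _ Ti Tj) => //=; [lia | case: (odd i) (odd j) ne => [] []].
by apply: (tight_order pv _ _ _ Tj Ti) => //=; [lia | case: (odd i) (odd j) ne => [] []].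
Qed.

(** * Inner runs in terms of descents *)

Definition inner (bs : seq (seq nat)) := behead (take (size bs).-1 bs).

Lemma desc_cat (b w : seq nat) (i : nat) :
  b != [::] -> sorted ltn b -> w != [::] -> head 0 w <= last 0 b ->
  desc (b ++ w) i = (i == (size b).-1) || (size b <= i) && desc w (i - size b).
Proof.
move=> nb sb nw mb.
have b0 : 0 < size b by case: (b) nb.
have w0 : 0 < size w by case: (w) nw.
rewrite /desc size_cat !nth_cat.
case: (ltngtP i.+1 (size b)) => [lt|gt|E].
- have -> : (i == (size b).-1) = false by lia.
  have := sorted_ltn_nth ltn_trans 0 sb; move/(_ i i.+1); rewrite !inE lt.
  by move=> /(_ (ltnW lt) isT (ltnSn i)); lia.
- have -> : i.+1 - size b = (i - size b).+1 by lia.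
  have -> : (i == (size b).-1) = false by lia.
  have -> : size b <= i by lia.
  by have -> : (i.+1 < size b + size w) = ((i - size b).+1 < size w) by lia.
- rewrite E subnn nth0; have -> : i = (size b).-1 by rewrite -E.
  rewrite eqxx.
  by rewrite nth_last mb; lia.
Qed.

(** For a descent [i], [i.+1] is the total length of the runs up to it; these partial sums share a
    parity exactly when the inner runs are even. *)
Lemma desc_runs (w : seq nat) (c : bool) :
  (forall i, desc w i -> odd i.+1 = c) <->
  (size (runs w) <= 1 \/
   (odd (size (head [::] (runs w))) = c /\
    all (fun r => ~~ odd (size r)) (inner (runs w)))).
Proof.
move: w c; apply: (blocks_ind (P := fun w bs => forall c,
  (forall i, desc w i -> odd i.+1 = c) <->
  (size bs <= 1 \/ (odd (size (head [::] bs)) = c /\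
    all (fun r => ~~ odd (size r)) (inner bs))))).
  by move=> c; split=> // _; left.
move=> b w nb sb mb IH c; case: (eqVneq w [::]) => [->|nw].
  split=> [_|_ i]; first by left.
  rewrite cats0 => /andP[li].
  have := sorted_ltn_nth ltn_trans 0 sb; move/(_ i i.+1); rewrite !inE.
  by move=> /(_ (ltnW li) li (ltnSn i)); lia.
have {}mb : head 0 w <= last 0 b by case: mb nw => [->//|]; rewrite -leqNgt.
have b0 : 0 < size b by case: (b) nb.
have [b2 [bs Ebs]] : exists b2 bs, blocks (fun x y => x < y) w = b2 :: bs.
  case: (w) nw => // x w' _; have [b' [w'' [_ -> _ _]]] := blocks_cons (fun x y => x < y) x w'.
  by exists (x :: b'), (blocks (fun x y => x < y) w'').
have Ein : inner (b :: blocks (fun x y => x < y) w) =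
    if size (blocks (fun x y => x < y) w) <= 1 then [::]
    else b2 :: inner (blocks (fun x y => x < y) w).
  by rewrite Ebs /inner /=; case: (bs) => [|b3 bs'] //=; rewrite take0.
have Estep : (forall i, desc (b ++ w) i -> odd i.+1 = c) <->
    odd (size b) = c /\ forall i, desc w i -> odd i.+1 = false.
  split=> [H|[Hb H] i].
    have Hb : odd (size b) = c.
      by rewrite -(H (size b).-1) ?prednK // desc_cat // eqxx.
    split=> // i di; have := H (size b + i).
    rewrite desc_cat // leq_addr addKn di orbT => /(_ isT).
    by rewrite -addnS oddD Hb; case: c {H Hb} => /=; case: (odd i).
  rewrite desc_cat // => /orP[/eqP->|/andP[li di]]; first by rewrite prednK.
  by rewrite -(subnKC li) -addnS oddD H // addbF.
rewrite Estep IH Ein Ebs /=.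
have -> : (size bs < 1) = (size bs == 0) by lia.
case: eqP => [->|/eqP s0] /=; split.
- by case=> Hb _; right.
- by case=> // -[Hb _]; split=> //; left.
- by case=> Hb [//|[-> ->]]; right.
- by case=> // -[Hb /andP[/negPf e2 ev]]; split=> //; right.
Qed.

Lemma inner_runs_even (w : seq nat) :
  (forall r, r \in inner_runs w -> ~~ odd (size r)) <->
  exists c, forall i, desc w i -> odd i = c.
Proof.
have sw c i : (odd i.+1 = ~~ c) <-> (odd i = c).
  by rewrite /=; split; case: (odd i) c => [] [].
split=> [ev|[c /(_ _ _)] H].
  exists (~~ odd (size (head [::] (runs w)))) => i di; apply/sw; rewrite negbK.
  by move: i di; apply/desc_runs; right; split=> //; apply/allP.
have /desc_runs[le1|[_ /allP//]] : forall i, desc w i -> odd i.+1 = ~~ c.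
  by move=> i di; apply/sw; apply: H.
by rewrite /inner_runs; case: (runs w) le1 => [|b []].
Qed.

(** * Flips of words whose falls have length at most two *)

Lemma flip_cons (x : nat) (w : seq nat) :
  w = [::] \/ x <= head 0 w -> flip (x :: w) = x :: flip w.
Proof.
case: w => [//|y w] [//|/= lxy].
have [b [bs E]] := blocks_head (fun x y => y < x) y w.
rewrite /flip /falls [blocks _ (x :: _)]/= -/(blocks _ (y :: w)) E.
by rewrite ltnNge lxy.
Qed.

Lemma flip_cons2 (x y : nat) (w : seq nat) :
  y < x -> w = [::] \/ y <= head 0 w -> flip [:: x, y & w] = [:: y, x & flip w].
Proof.
move=> lyx; case: w => [_|z w [//|/= lyz]]; first by rewrite /flip /falls /= lyx.
have [b [bs E]] := blocks_head (fun x y => y < x) z w.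
rewrite /flip /falls [blocks _ (x :: _)]/= -/(blocks _ (z :: w)) E.
by rewrite ltnNge lyz /= lyx.
Qed.

Lemma flip_alternating_from (f g : nat -> nat) (c : bool) (N m a : nat) :
  a + m = N -> (m != 0 -> odd a = c) ->
  (forall x, x.+1 < N -> odd x = c ->
     [/\ f x.+1 < f x, g x = f x.+1 & g x.+1 = f x]) ->
  (forall x, x.+1 < N -> odd x != c -> f x < f x.+1) ->
  (odd N != c -> g N.-1 = f N.-1) ->
  flip (map f (iota a m)) = map g (iota a m).
Proof.
move=> EN ea H1 H2 H4; have [k] := ubnP m.
elim: k m a EN ea => // k IH [|[|m]] a EN ea lk //=.
  have EN' : a = N.-1 by lia.
  rewrite [in LHS]EN' -H4 -?EN' // -EN addn1 /= ea //.
  by case: (c).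
have oa := ea isT; have [lt g0 g1] := H1 a ltac:(lia) oa.
rewrite flip_cons2 ?g0 ?g1 //; last first.
  case: m EN {ea lk} => [|m] EN; [by left | right => /=; apply/ltnW/H2; first by lia].
  by rewrite /= oa; case: (c).
by rewrite IH //=; [lia | rewrite negbK | lia].
Qed.

Lemma flip_alternating (f g : nat -> nat) (c : bool) (N : nat) :
  (forall x, x.+1 < N -> odd x = c ->
     [/\ f x.+1 < f x, g x = f x.+1 & g x.+1 = f x]) ->
  (forall x, x.+1 < N -> odd x != c -> f x < f x.+1) ->
  (c -> g 0 = f 0) ->
  (odd N != c -> g N.-1 = f N.-1) ->
  flip (mkseq f N) = mkseq g N.
Proof.
move=> H1 H2 H3 H4; rewrite /mkseq; case: c H1 H2 H3 H4 => H1 H2 H3 H4; last first.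
  exact: (flip_alternating_from (c := false) (N := N)).
case: N H1 H2 H4 => [//|N] H1 H2 H4 /=.
rewrite flip_cons ?H3 //; last first.
  by case: N H1 H2 H4 => [|N] H1 H2 H4; [left | right; apply/ltnW/H2].
by rewrite (flip_alternating_from (c := true) (N := N.+1) (g := g)) // add1n.
Qed.

(** * The odd-even network run backwards *)

(* The transpositions (x, x+1), x in D, are disjoint, and [swaps D] is their
   product, only when D has no two consecutive elements. *)
Definition swaps (D : pred nat) (x : nat) : nat :=
  if D x then x.+1 else if (0 < x) && D x.-1 then x.-1 else x.

(** Values move by at most one, so only [b <= a + 2] matters; at distance two a collision would need
    both [D a] and [D a.+1], of opposite parity. *)
Lemma swaps_lt (D : pred nat) (c : bool) (a b : nat) :
  (forall x, D x -> odd x = c) -> a < b -> ~~ ((b == a.+1) && (odd a == c)) ->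
  swaps D a < swaps D b.
Proof.
move=> Dc lab nab; rewrite /swaps.
have := Dc a; have := Dc b; have := Dc a.-1; have := Dc b.-1.
by case: ifP => _; [|case: ifP => [/andP[_ ->]|_]];
  (case: ifP => _; [|case: ifP => [/andP[_ ->]|_]]); lia.
Qed.

(* Odd-even transposition network on [n] wires run backwards from the identity:
   at time [s] the entries at positions [p = s + c mod 2] move right, the others
   move left, and an entry reaching an end waits for one step before turning
   around.  [wire n c s p] is the entry at position [p] at time [s]. *)
Definition wire (n : nat) (c : bool) (s p : nat) : nat :=
  if odd (p + s) == c then (if s <= p then p - s else s - p - 1)
  else (if p + s < n then p + s else n.*2 - 1 - p - s).

Lemma wire_swap (n s x : nat) (c : bool) : x.+1 < n -> odd (x + s) = c ->
  wire n c s.+1 x.+1 = wire n c s x /\ wire n c s.+1 x = wire n c s x.+1.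
Proof.
by move=> lx ox; rewrite /wire; split; do ?case: ifP; lia.
Qed.

Lemma wire_left (n s : nat) (c : bool) : s.+1 < n -> odd s != c ->
  wire n c s.+1 0 = wire n c s 0.
Proof.
by move=> ls os; rewrite /wire; do ?case: ifP; lia.
Qed.

Lemma wire_right (n s : nat) (c : bool) : s.+1 < n -> odd (n.-1 + s) = c ->
  wire n c s.+1 n.-1 = wire n c s n.-1.
Proof.
by move=> ls os; rewrite /wire; do ?case: ifP; lia.
Qed.

(** The two values differ by [2s + 1], [2x + 2], [2(n - 1 - x)] or [2(n - s) - 1]. The gap is one
    only in the last case with [s = n - 1], where the smaller value [s - x - 1] has the parity other
    than [c]. *)
Lemma wire_lt (D : pred nat) (n s x : nat) (c : bool) :
  (forall x, D x -> odd x = c) -> 0 < s < n -> x.+1 < n -> odd (x + s) = c ->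
  swaps D (wire n c s x) < swaps D (wire n c s x.+1).
Proof.
by move=> Dc ls lx ox; apply: (swaps_lt Dc); rewrite /wire; do ?case: ifP; lia.
Qed.

(** At time 1 all pairs of parity [c] are exchanged; exchanging those outside [D] again leaves those
    in [D]. *)
Lemma swaps_wire1 (D : pred nat) (n p : nat) (c : bool) :
  (forall x, D x -> x.+1 < n /\ odd x = c) -> 1 < n -> p < n ->
  swaps (fun x => [&& x.+1 < n, odd x == c & ~~ D x]) (wire n c 1 p) = swaps D p.
Proof.
move=> Dc n1 lp; have D0 := Dc p; have D1 := Dc p.-1.
have [op|op] := eqVneq (odd p) c; last first.
  have -> : wire n c 1 p = p.-1 by rewrite /wire; do ?case: ifP; lia.
  case: p lp D0 D1 op => [|p] lp D0 D1 op; rewrite /swaps /=.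
    by do ?case: ifP; lia.
  by move: D0 D1; case: (D p) => D0 D1; do ?case: ifP; lia.
have -> : wire n c 1 p = if p.+1 < n then p.+1 else p.
  by rewrite /wire; do ?case: ifP; lia.
case: ifP => lpn; rewrite /swaps /=; last by do ?case: ifP; lia.
by move: D0 D1; case: (D p) => D0 D1; do ?case: ifP; lia.
Qed.

Lemma flip_wire (D : pred nat) (n s : nat) (c : bool) :
  (forall x, D x -> odd x = c) -> 0 < s -> s.+1 < n ->
  flip (mkseq (fun p => (swaps D (wire n c s.+1 p)).+1) n) =
  mkseq (fun p => (swaps D (wire n c s p)).+1) n.
Proof.
(* This is the parity of the places where the pairs exchanged between times [s] and [s.+1] begin. *)
move=> Dc s0 sn; apply: (@flip_alternating _ _ (odd s (+) c)).
- move=> x lx ox; have oxs : odd (x + s) = c by lia.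
  have [E1 E2] := wire_swap lx oxs.
  by rewrite E1 E2; split=> //; rewrite ltnS (wire_lt Dc) //; lia.
- by move=> x lx ox; rewrite ltnS (wire_lt Dc) //; lia.
- by move=> os; rewrite wire_left //; lia.
- by move=> oN; rewrite wire_right //; lia.
Qed.

Lemma iter_flip_wire (D : pred nat) (n s : nat) (c : bool) :
  (forall x, D x -> odd x = c) -> s.+1 < n ->
  iter s flip (mkseq (fun p => (swaps D (wire n c s.+1 p)).+1) n) =
  mkseq (fun p => (swaps D (wire n c 1 p)).+1) n.
Proof.
move=> Dc; elim: s => // s IH sn.
by rewrite iterSr flip_wire // IH // ltnW.
Qed.

Lemma swaps_iter_flip (D : pred nat) (n : nat) (c : bool) :
  2 <= n -> (forall x, D x -> x.+1 < n /\ odd x = c) ->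
  exists v, mkseq (fun p => (swaps D p).+1) n = iter (n - 2) flip v.
Proof.
(* Exchanging the complement of [D] beforehand makes the [n - 2] flips from time [n - 1] to time 1
   end in [swaps D]. *)
move=> n2 Dc; pose E x := [&& x.+1 < n, odd x == c & ~~ D x].
exists (mkseq (fun p => (swaps E (wire n c (n - 2).+1 p)).+1) n).
rewrite iter_flip_wire; [|by move=> x /and3P[_ /eqP] | by lia].
by apply/eq_in_map => p; rewrite mem_iota => lp; rewrite swaps_wire1 //; lia.
Qed.

(** * Words of permutations and thin permutations *)

Lemma size_word (n : nat) (t : 'S_n) : size (word t) = n.
Proof. by rewrite size_map size_enum_ord. Qed.

Lemma nth_word (n : nat) (t : 'S_n) (i : 'I_n) : nth 0 (word t) i = (t i).+1.
Proof.
by rewrite (nth_map i) ?size_enum_ord // nth_ord_enum.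
Qed.

Lemma word_inj (n : nat) : injective (@word n).
Proof.
move=> s t E; apply/permP => i; apply/val_inj/eq_add_S.
by rewrite -!nth_word E.
Qed.

Lemma perm_word (n : nat) (t : 'S_n) : perm_eq (word t) (iota 1 n).
Proof.
have uw : uniq (word t).
  by rewrite map_inj_uniq ?enum_uniq // => i j /eq_add_S/val_inj/perm_inj.
have sub : {subset word t <= iota 1 n}.
  by move=> x /mapP[i _ ->]; rewrite mem_iota add1n !ltnS ltn_ord.
apply: uniq_perm; rewrite ?iota_uniq //.
have sz : size (iota 1 n) <= size (word t) by rewrite size_word size_iota.
by move=> x; have [] := uniq_min_size uw sub sz.
Qed.

Lemma word_surj (n : nat) (v : seq nat) :
  perm_eq v (iota 1 n) -> exists p : 'S_n, word p = v.
Proof.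
move=> pv; have sv := size_perm_iota pv.
have bv (i : 'I_n) : 0 < nth 0 v i <= n.
  have : nth 0 v i \in v by rewrite mem_nth ?sv.
  by rewrite (perm_mem pv) mem_iota; lia.
have lv (i : 'I_n) : (nth 0 v i).-1 < n by have := bv i; lia.
have inj : injective (fun i => Ordinal (lv i)).
  move=> i j /(congr1 val) /= E; apply/val_inj/eqP.
  have uv : uniq v by rewrite (perm_uniq pv) iota_uniq.
  rewrite -(nth_uniq 0 _ _ uv) ?sv ?ltn_ord //.
  case/andP: (bv i) (bv j) => i0 _ /andP[j0 _].
  by rewrite -(prednK i0) -(prednK j0) E.
exists (perm inj); apply: (@eq_from_nth _ 0); first by rewrite size_word sv.
rewrite size_word => i lin; rewrite (nth_word _ (Ordinal lin)) permE /=.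
by have := bv (Ordinal lin); rewrite /=; lia.
Qed.

Definition thin (n : nat) (t : 'S_n) : Prop :=
  forall i : 'I_n, t i <= i.+1 /\ i <= (t i).+1.

Lemma thinV (n : nat) (t : 'S_n) : thin t -> thin t^-1%g.
Proof. by move=> tt i; have := tt (t^-1%g i); rewrite permKV; lia. Qed.

(* The preimage of [i] is [i+1]: otherwise it is [i-1], and the same argument
   at [i-1] gives [t i = i-1]. *)
Lemma thin_up (n : nat) (t : 'S_n) (i j : 'I_n) :
  thin t -> t i = i.+1 :> nat -> j = i.+1 :> nat -> t j = i.
Proof.
move=> tt; have [m] := ubnP (i : nat); elim: m i j => // m IH i j lim ti ji.
have := tt (t^-1%g i); rewrite permKV => -[h1 h2].
set l := t^-1%g i in h1 h2; have tl : t l = i by rewrite permKV.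
have nli : l != i by apply/eqP => E; move: ti; rewrite -E tl E; lia.
have {}nli : l != i :> nat by [].
have [El|El] : (l = i.+1 :> nat) \/ i = l.+1 :> nat by lia.
  by have -> : j = l by apply: val_inj; rewrite /= ji El.
have := IH l i ltac:(lia); rewrite tl => /(_ El El) E.
by have := congr1 val E; rewrite /= ti El; lia.
Qed.

Lemma desc_word (n : nat) (t : 'S_n) (i : 'I_n) (j : 'I_n) :
  j = i.+1 :> nat -> desc (word t) i = (t j < t i).
Proof.
move=> ji; rewrite /desc size_word -ji ltn_ord !nth_word ltnS leq_eqVlt /=.
case: eqP => // /val_inj/perm_inj E; move: ji; rewrite E; lia.
Qed.

(** At a descent thinness forces an exchange of [i] and [i + 1]; conversely [thin_up], for [t] or
    its inverse, makes every moved point part of such an exchange. *)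
Lemma thin_swaps (n : nat) (t : 'S_n) :
  thin t -> word t = mkseq (fun x => (swaps (desc (word t)) x).+1) n.
Proof.
move=> tt; apply: (@eq_from_nth _ 0); first by rewrite size_word size_mkseq.
rewrite size_word => x lx; rewrite nth_mkseq //; set i := Ordinal lx.
rewrite -[x]/(val i) (nth_word t i); congr _.+1; rewrite /swaps.
case: ifP => [di|ndi].
  have lx1 : x.+1 < n by move: di => /andP[]; rewrite size_word.
  move: di; rewrite (desc_word _ (j := Ordinal lx1)) //.
  by have := tt i; have := tt (Ordinal lx1); rewrite /=; lia.
case: ifP => [/andP[x0 di]|ndi'].
  have lx1 : x.-1 < n by lia.
  move: di; rewrite (desc_word _ (i := Ordinal lx1) (j := i)) ?prednK //.
  by have := tt i; have := tt (Ordinal lx1); rewrite /=; lia.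
have [h1 h2] := tt i.
have [E|[E|//]] : t i = i.+1 :> nat \/ i = (t i).+1 :> nat \/ t i = i :> nat by lia.
  have lx1 : x.+1 < n by have := ltn_ord (t i); rewrite E.
  have := thin_up tt E (j := Ordinal lx1) erefl => E'.
  by move: ndi; rewrite (desc_word _ (j := Ordinal lx1)) // E' E leqnn.
have := thin_up (thinV tt) (i := t i) (j := i); rewrite permK => /(_ E E).
move/(canRL (permKV t)) => Ei.
have di : desc (word t) (t i) by rewrite (desc_word _ E) -Ei; lia.
have Ex : x = (t i).+1 := E.
by move: ndi'; rewrite /= {1 2}Ex /= di.
Qed.

Lemma iter_flip_imageP (n : nat) (t : 'S_n) : 2 <= n ->
  (exists p : 'S_n, word t = iter (n - 2) flip (word p)) <->
  thin t /\ exists c, forall i, desc (word t) i -> odd i = c.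
Proof.
move=> n2; split=> [[p E]|[tt [c Dc]]].
  split=> [i|].
    have := iter_flip_thin n2 (perm_word p) (ltn_ord i); rewrite -E nth_word /=.
    by rewrite !ltnS.
  case: (pickP (fun i : 'I_n => desc (word t) i)) => [i di|nd].
    exists (odd i) => j dj.
    by apply: (iter_flip_desc_parity n2 (perm_word p)); rewrite -E.
  exists true => i di; have lin : i < n.
    by move: di => /andP[]; rewrite size_word; lia.
  by have := nd (Ordinal lin); rewrite /= di.
have [v Ev] : exists v, word t = iter (n - 2) flip v.
  rewrite {1}thin_swaps //; apply: (swaps_iter_flip (c := c)) => // x dx.
  by split; [move: dx => /andP[]; rewrite size_word | apply: Dc].
have [p Ep] : exists p : 'S_n, word p = v.
  apply: word_surj; rewrite -(permPl (perm_iter_flip (n - 2) v)) -Ev.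
  exact: perm_word.
by exists p; rewrite Ep.
Qed.

Lemma distn_thin (n : nat) (t : 'S_n) :
  \max_(i < n) `|(t i).+1 - i.+1| <= 1 <-> thin t.
Proof.
split=> [/bigmax_leqP H i|tt]; first by have := H i isT; lia.
by apply/bigmax_leqP => i _; have := tt i; lia.
Qed.

(** * Counting by descent sets *)

Definition parity_class (n : nat) (c : bool) : {set 'I_n} :=
  [set i : 'I_n | (i.+1 < n) && (odd i == c)].

Definition desc_set (n : nat) (t : 'S_n) : {set 'I_n} :=
  [set i : 'I_n | desc (word t) i].

Lemma desc_setE (n : nat) (t : 'S_n) (x : nat) :
  desc (word t) x = [exists i in desc_set t, x == i :> nat].
Proof.
apply/idP/exists_inP => [dx|[i]]; last by rewrite inE => di /eqP->.
have lx : x < n by move: dx => /andP[]; rewrite size_word; lia.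
by exists (Ordinal lx); rewrite ?inE.
Qed.

Lemma desc_set_inj (n : nat) (s t : 'S_n) :
  thin s -> thin t -> desc_set s = desc_set t -> s = t.
Proof.
move=> ts tt E; apply: word_inj; rewrite (thin_swaps ts) (thin_swaps tt).
apply: eq_mkseq => x; congr _.+1.
by rewrite /swaps !desc_setE E.
Qed.

Lemma swapsK (D : pred nat) (c : bool) :
  (forall x, D x -> odd x = c) -> involutive (swaps D).
Proof.
move=> Dc x; rewrite {2}/swaps.
case: ifP => [Dx|nDx].
  have nD : D x.+1 = false by have := Dc x; have := Dc x.+1; lia.
  by rewrite /swaps nD /= Dx.
case: ifP => [/andP[x0 Dx]|nDx']; first by rewrite /swaps Dx prednK.
by rewrite /swaps nDx nDx'.
Qed.

Lemma desc_set_surj (n : nat) (c : bool) (A : {set 'I_n}) :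
  A \subset parity_class n c -> exists2 t : 'S_n, thin t & desc_set t = A.
Proof.
move=> /subsetP sA; pose D x := [exists i in A, x == i :> nat].
have DA (i : 'I_n) : D i = (i \in A).
  by apply/exists_inP/idP => [[j jA /eqP/val_inj->]|iA] //; exists i.
have Dc x : D x -> x.+1 < n /\ odd x = c.
  by case/exists_inP => i /sA; rewrite inE => /andP[? /eqP ?] /eqP->.
have Dodd x : D x -> odd x = c by case/Dc.
have lt (i : 'I_n) : swaps D i < n.
  by rewrite /swaps; have := Dc i; have := ltn_ord i; do ?case: ifP; lia.
have inj : injective (fun i => Ordinal (lt i)).
  by move=> i j /(congr1 val) /= /(can_inj (swapsK Dodd))/val_inj.
exists (perm inj).
  by move=> i; rewrite permE /= /swaps; do ?case: ifP; lia.
apply/setP => i; rewrite inE -DA; have [li|li] := ltnP i.+1 n; last first.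
  by rewrite /desc size_word ltnNge li; apply/esym/negbTE/negP => /Dc[]; lia.
rewrite (desc_word _ (j := Ordinal li)) // !permE /= /swaps /=.
by have := Dodd i; have := Dodd i.+1; case: (D i); do ?case: ifP; lia.
Qed.

Lemma sum_odd (m : nat) (c : bool) :
  \sum_(i < m) (odd i == c) = if c then m./2 else uphalf m.
Proof.
elim: m => [|m IH]; first by rewrite big_ord0; case: c.
by rewrite big_ord_recr /= IH; case: c {IH}; lia.
Qed.

Lemma card_parity_class (n : nat) (c : bool) :
  #|parity_class n.+1 c| = if c then n./2 else uphalf n.
Proof.
rewrite -sum_odd -sum1_card big_mkcond big_ord_recr /= inE ltnn addn0.
apply: eq_bigr => i _; rewrite inE /= ltnS ltn_ord /=.
by case: (_ == _).
Qed.

Theorem theorem27 (n : nat) (hn : 2 <= n) :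
  (forall t : 'S_n,
     (exists p : 'S_n, word t = iter (n - 2) flip (word p)) <->
     (\max_(i < n) `|(t i).+1 - i.+1| <= 1 /\
      forall r : seq nat, r \in inner_runs (word t) -> ~~ odd (size r))) /\
  #|[set t : 'S_n | [exists p : 'S_n, word t == iter (n - 2) flip (word p)]]| =
    if odd n then 2 ^ (n.+1)./2 - 1
    else 2 ^ (n./2 - 1) + 2 ^ n./2 - 1.
Proof.
split=> [t|]; first by rewrite iter_flip_imageP // distn_thin inner_runs_even.
set S := [set _ | _].
have inS t : t \in S <-> thin t /\ exists c, forall i, desc (word t) i -> odd i = c.
  rewrite inE -iter_flip_imageP //; split=> [/existsP[p /eqP Ep]|[p Ep]]; first by exists p.
  by apply/existsP; exists p; apply/eqP.
have injS : {in S &, injective (@desc_set n)}.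
  by move=> s t /inS[ts _] /inS[tt _]; apply: desc_set_inj.
have imS : @desc_set n @: S =
    powerset (parity_class n false) :|: powerset (parity_class n true).
  apply/setP => A; rewrite in_setU !powersetE; apply/imsetP/orP.
    case=> t /inS[_ [c Dc]] ->.
    suff: desc_set t \subset parity_class n c by case: (c); [right | left].
    apply/subsetP => i; rewrite !inE => di; rewrite (Dc _ di) eqxx andbT.
    by move: di => /andP[]; rewrite size_word.
  move=> H; have [c sA] : exists c, A \subset parity_class n c.
    by case: H; [exists false | exists true].
  have [t tt EA] := desc_set_surj sA; exists t => //; apply/inS; split=> //.
  exists c => i; rewrite desc_setE EA => /exists_inP[j /(subsetP sA)].
  by rewrite inE => /andP[_ /eqP <-] /eqP->.
rewrite -(card_in_imset injS) imS cardsU !card_powerset.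
(* The parity classes are disjoint, so only the empty descent set, that of the identity, is counted
   twice. *)
have -> : powerset (parity_class n false) :&: powerset (parity_class n true)
    = [set set0].
  rewrite -powersetI -powerset0; congr powerset; apply/setP => i.
  by rewrite !inE; lia.
rewrite cards1; case: n hn {S inS injS imS} => // n hn.
rewrite !card_parity_class /=.
(* The size is now [n.+1]: the two classes are equally large for even [n] and differ by one element
   for odd [n]. *)
have -> : uphalf n = if odd n then n./2.+1 else n./2 by case: ifP; lia.
by case: (odd n) => /=; rewrite ?subn1 /= ?addnn ?expnS ?mul2n // addnC.
Qed.
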